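(* The eigenfrequency $\omega$ of a localised eigenmode of the Helmholtz problem $\mathcal{L}u=\omega^2u$ must satisfy $$\begin{pmatrix}-V_{21}^{[B]}(\omega) & V_{11}^{[B]}(\omega)\end{pmatrix}\begin{pmatrix}V_{11}^{[A]}(\omega)\\ -V_{21}^{[A]}(\omega)\end{pmatrix}=0,$$ where $(V_{11}^{[A]}(\omega),V_{21}^{[A]}(\omega))^{\top}$ is the eigenvector of the transfer matrix $T_p^{[A]}$ associated to the eigenvalue $\lambda_1^{[A]}$ with $|\lambda_1^{[A]}|<1$, and $(V_{11}^{[B]}(\omega),V_{21}^{[B]}(\omega))^{\top}$ is the eigenvector of the transfer matrix $T_p^{[B]}$ associated to the eigenvalue $\lambda_1^{[B]}$ with $|\lambda_1^{[B]}|<1$.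
   Context: Setting. $\mu_0>0$ is a constant and $\varepsilon_1,\varepsilon_2$ are real-valued continuous functions of the frequency $\omega\in\mathbb{R}$, finite and non-zero at the frequencies considered. For each material $j\in\{A,B\}$ the unit cell $[0,1]$ is divided into consecutive intervals in the order $D^{[1]}_1,D^{[2]}_1,D^{[1]}_2,\dots,D^{[2]}_N,D^{[1]}_{N+1}$ (the geometry depends on $j$); $\varepsilon^{j}(x,\omega)$ is $1$-periodic in $x$, equal to $\varepsilon_1(\omega)$ on the $D^{[1]}_i$ and to $\varepsilon_2(\omega)$ on the $D^{[2]}_i$, and mirror symmetric, $\varepsilon^{j}(x,\omega)=\varepsilon^{j}(1-x,\omega)$ for $x\in[0,1]$. The full structure has $\varepsilon=\varepsilon^{A}$ for $x<0$ and $\varepsilon=\varepsilon^{B}$ for $x>0$. The endpoints of the periodic cells are $x_n=n$, $n\in\mathbb{Z}$, and the interface is $x_0=0$. The operator is $\mathcal{L}u=-\frac{1}{\mu_0}\frac{d}{dx}\left(\frac{1}{\varepsilon(x,\omega)}\frac{du}{dx}\right)$, with $u$ and $\frac1\varepsilon u'$ continuous. A localised eigenmode with eigenfrequency $\omega$ is a non-zero solution $u$ of $\mathcal{L}u=\omega^2u$ on $\mathbb{R}$ with $u(x_n)\to0$ and $u'(x_n)\to0$ as $n\to\pm\infty$. Transfer matrices. $T_p^{[j]}=T_p^{[j]}(\omega)$ is the $2\times2$ transfer matrix over one periodic cell of material $j$: for every solution $u$ of the equation in material $j$, $(u(x_{n+1}),u'(x_{n+1}))^\top=T_p^{[j]}(u(x_n),u'(x_n))^\top$.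 It has determinant $1$. *)

(* Defs.v *)
From HB Require Import structures.
From mathcomp Require Import all_boot all_order all_algebra.
From mathcomp Require Import complex.
From mathcomp Require Import all_classical all_reals all_analysis.
Import numFieldNormedType.Exports.
Import Order.TTheory GRing.Theory Num.Theory.

Set Implicit Arguments.
Unset Strict Implicit.
Unset Printing Implicit Defensive.

Local Open Scope ring_scope.
Local Open Scope classical_set_scope.
Local Open Scope complex_scope.

(* The library's [derive] needs domain and codomain to be normed modules over
   the same field, which is not the case for functions from R to R[i].  The
   regular module R[i]^o carries the topology given by the complex modulus. *)
Definition cquotient (R : realType) (u : R -> R[i]) (x h : R) : R[i]^o :=
  (h^-1)%:C * (u (x + h) - u x).

Definition cderivable (R : realType) (u : R -> R[i]) (x : R) : Prop :=
  cvg (cquotient u x h @[h --> 0^']).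

Definition cderiv (R : realType) (u : R -> R[i]) (x : R) : R[i] :=
  lim (cquotient u x h @[h --> 0^']).

Definition ccontinuous (R : realType) (u : R -> R[i]) : Prop :=
  continuous (u : R -> R[i]^o).

Definition cvanishes (R : realType) (z : nat -> R[i]) : Prop :=
  (z n : R[i]^o) @[n --> \oo] --> (0 : R[i]^o).

(* Subdivision 0 = node 0 < node 1 < ... < node (2N+1) = 1 of the unit cell,
   where, for 0 <= i,
     D^[1]_(i+1) lies between node (2i)   and node (2i+1)   (i <= N),
     D^[2]_(i+1) lies between node (2i+1) and node (2i+2)   (i < N). *)
Record cell (R : realType) := Cell {
  npairs : nat ;
  node : nat -> R ;
  npairs_gt0 : (0 < npairs)%N ;
  node_first : node 0 = 0 ;
  node_last : node npairs.*2.+1 = 1 ;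
  node_incr : forall i, (i < npairs.*2.+1)%N -> node i < node i.+1
}.

Definition fracpart (R : realType) (x : R) : R := x - (Num.floor x)%:~R.

(* The value at the end points of the intervals is immaterial: every use of
   [permittivity] below discards these points.  Assigning them to D^[1] makes
   pointwise mirror symmetry possible. *)
Definition permittivity (R : realType) (c : cell R) (eps1 eps2 : R -> R)
    (x omega : R) : R :=
  if [exists i : 'I_(npairs c),
        node c i.*2.+1 < fracpart x < node c i.*2.+2]
  then eps2 omega else eps1 omega.

(* Points where the two constituents of one periodic material meet.  The cell
   end points n are not among them: D^[1] lies on both sides. *)
Definition material_breaks (R : realType) (c : cell R) : set R :=
  [set x | exists2 i : nat, (0 < i < (npairs c).*2.+1)%N & fracpart x = node c i].

Definition full_permittivity (R : realType) (A B : cell R)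
    (eps1 eps2 : R -> R) (x omega : R) : R :=
  if x < 0 then permittivity A eps1 eps2 x omega
  else permittivity B eps1 eps2 x omega.

Definition full_breaks (R : realType) (A B : cell R) : set R :=
  [set x | [\/ x < 0 /\ material_breaks A x, x = 0
             | 0 < x /\ material_breaks B x]].

(* u solves L u = omega^2 u, where L u = - mu0^-1 ((1/e) u')', for a
   coefficient e that is locally constant off S.  The continuity of (1/e) u'
   across S is expressed by a continuous w equal to (1/e) u' off S. *)
Definition helmholtz_solution (R : realType) (mu0 : R) (e : R -> R) (S : set R)
    (omega : R) (u : R -> R[i]) : Prop :=
  ccontinuous u /\
  exists2 w : R -> R[i], ccontinuous w &
    forall x, ~ S x ->
      [/\ cderivable u x,
          w x = ((e x)^-1)%:C * cderiv u x,
          cderivable w x &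
          - (mu0^-1)%:C * cderiv w x = (omega ^+ 2)%:C * u x].

Definition material_solution (R : realType) (mu0 : R) (c : cell R)
    (eps1 eps2 : R -> R) (omega : R) (u : R -> R[i]) : Prop :=
  helmholtz_solution mu0 (fun x => permittivity c eps1 eps2 x omega)
    (material_breaks c) omega u.

Definition full_solution (R : realType) (mu0 : R) (A B : cell R)
    (eps1 eps2 : R -> R) (omega : R) (u : R -> R[i]) : Prop :=
  helmholtz_solution mu0 (fun x => full_permittivity A B eps1 eps2 x omega)
    (full_breaks A B) omega u.

Definition col2 (K : Type) (a b : K) : 'cV[K]_2 :=
  \col_(i < 2) (if i == ord0 then a else b).

Definition row2 (K : Type) (a b : K) : 'rV[K]_2 :=
  \row_(i < 2) (if i == ord0 then a else b).

Definition state (R : realType) (u : R -> R[i]) (x : R) : 'cV[R[i]]_2 :=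
  col2 (u x) (cderiv u x).

Definition is_transfer_matrix (R : realType) (mu0 : R) (c : cell R)
    (eps1 eps2 : R -> R) (omega : R) (T : 'M[R[i]]_2) : Prop :=
  forall u, material_solution mu0 c eps1 eps2 omega u ->
  forall n : int, state u (n + 1)%:~R = T *m state u n%:~R.

Definition localised_eigenmode (R : realType) (mu0 : R) (A B : cell R)
    (eps1 eps2 : R -> R) (omega : R) (u : R -> R[i]) : Prop :=
  [/\ full_solution mu0 A B eps1 eps2 omega u,
      exists x, u x != 0,
      cvanishes (fun n => u n%:R) /\ cvanishes (fun n => cderiv u n%:R) &
      cvanishes (fun n => u (- n%:R)) /\
      cvanishes (fun n => cderiv u (- n%:R))].

Definition mirror_symmetric (R : realType) (c : cell R) (eps1 eps2 : R -> R)
    (omega : R) : Prop :=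
  forall x, 0 <= x <= 1 ->
    permittivity c eps1 eps2 x omega = permittivity c eps1 eps2 (1 - x) omega.

(* Column eigenvectors; the library's [eigenspace] is about row vectors. *)
Definition is_eigenvector (K : fieldType) (T : 'M[K]_2) (lambda : K)
    (V : 'cV[K]_2) : Prop :=
  V != 0 /\ T *m V = lambda *: V.

(* Main.v *)
Require Import Defs.
From HB Require Import structures.
From mathcomp Require Import all_boot all_order all_algebra.
From mathcomp Require Import complex ring lra zify.
From mathcomp Require Import all_classical all_reals all_analysis.
Import numFieldNormedType.Exports.
Import Order.TTheory GRing.Theory Num.Theory.

(** Put [w = u' / eps].  The Helmholtz equation becomes the first order system
[u' = eps w], [w' = - m u] with [m = mu0 omega^2], where [u] and [w] are
continuous across the breaks.  For two solutions [(u, w)] and [(v, z)] with the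
same coefficient [eps], the Wronskian [u z - w v] has derivative zero off the
breaks; the breaks are locally finite, so it is constant
([wronskian_constant]).

In material [B], take the solution [v] on the whole line whose state
[(v 0, v' 0)] is the eigenvector [VB].  Then [state v n = lambdaB ^ n * VB] is
bounded in [n >= 0], while the mode tends to zero with its derivative.  Hence
the Wronskian of [u] and [v] on [x >= 0] tends to zero, so it vanishes at [0]:
the vector [(u 0, eps1 (w 0))] is parallel to [VB]
([eigenmode_state_parallel]).  On the other side, mirror symmetry together with
periodicity makes the permittivity of [A] an even function, so
[x |-> u (- x)] solves the equation of material [A] on [x >= 0], and the same
argument shows that [(u 0, - eps1 (w 0))] is parallel to [VA].  The two
proportionalities give the claim as soon as [(u 0, w 0)] is not zero, and it is
not, by uniqueness for the initial value problem ([solves_on_zero]).  Neither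
[det T = 1] nor the second eigenvalue of [T] is needed.

What remains is the existence of [v] ([material_solution_exists]).  On an
interval where the coefficient is constant, solutions are combinations of
circular or hyperbolic sines and cosines.  They are glued at the breaks
([solvable_on_glue]), first over a period and then over arbitrarily long
intervals; by uniqueness the solutions on increasing intervals agree, and they
define one on the whole line ([solvable_global]).

The coefficients are real, so the real and imaginary parts of a solution are
solutions.  The analysis is done for real functions. *)

Set Implicit Arguments.
Unset Strict Implicit.
Unset Printing Implicit Defensive.

Local Open Scope ring_scope.
Local Open Scope classical_set_scope.

(** * The first order system with real coefficients *)

Section RealSystem.
Context {R : realType}.
Implicit Types (f g e : R -> R) (S : set R) (l r m x t p : R).

(** The finite exceptional set is given as a sequence, on which the proof
inducts by splitting the interval at an exceptional point. *)
Lemma constant_off_finite f (D : seq R) l r : l <= r -> continuous f ->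
  (forall x, l < x < r -> x \notin D -> is_derive x 1 f 0) -> f l = f r.
Proof.
move=> + cf; elim: D l r => [|d D IH] l r lr df.
  have := @MVT_segment R f (cst 0) l r lr; case.
  - by move=> x; rewrite in_itv/= => lxr; exact: df.
  - exact: continuous_subspaceT.
  - by move=> c _ /=; rewrite mul0r => /eqP; rewrite subr_eq0 => /eqP.
have [/andP[ld dr]|ldr] := boolP (l < d < r).
  transitivity (f d).
    apply: IH => [|x /andP[lx xd] xD]; first exact: ltW.
    by apply: df; rewrite ?lx ?(lt_trans xd)// inE negb_or (lt_eqF xd).
  apply: IH => [|x /andP[dx xr] xD]; first exact: ltW.
  by apply: df; rewrite ?xr ?(lt_trans ld)// inE negb_or (gt_eqF dx).
apply: IH => // x lxr xD; apply: df => //; rewrite inE negb_or xD andbT.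
by apply: contraNneq ldr => <-.
Qed.

(** [f] and [g] are continuous on the whole line and solve [f' = e g],
[g' = - m f] at the points of [l, r], both excluded, that are not in the set
[S] of breaks. *)
Definition solves_on m e S l r f g :=
  [/\ continuous f, continuous g &
      forall x, l < x < r -> ~ S x ->
        is_derive x 1 f (e x * g x) /\ is_derive x 1 g (- (m * f x))].

Lemma solves_on_sub m e S l r l' r' f g :
  l <= l' -> r' <= r -> solves_on m e S l r f g -> solves_on m e S l' r' f g.
Proof.
move=> ll rr [cf cg df]; split=> // x /andP[lx xr]; apply: df.
by rewrite (le_lt_trans ll) ?(lt_le_trans xr).
Qed.

(** The two solutions may have different breaks, but the coefficient is the
same. *)
Lemma wronskian_constant m e S1 S2 l r f1 g1 f2 g2 : l <= r ->
  finite_set (S1 `&` [set x | l < x < r]) ->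
  finite_set (S2 `&` [set x | l < x < r]) ->
  solves_on m e S1 l r f1 g1 -> solves_on m e S2 l r f2 g2 ->
  f1 l * g2 l - g1 l * f2 l = f1 r * g2 r - g1 r * f2 r.
Proof.
move=> lr /finite_seqP[D1 D1E] /finite_seqP[D2 D2E].
move=> [cf1 cg1 d1] [cf2 cg2 d2].
pose W := (f1 * g2 - g1 * f2)%R.
apply: (@constant_off_finite W (D1 ++ D2)) => //.
  by move=> x; apply: continuousB; apply: continuousM; [exact: cf1|exact: cg2|exact: cg1|exact: cf2].
move=> x lxr; rewrite mem_cat negb_or => /andP[xD1 xD2].
have nS1 : ~ S1 x.
  by move=> Sx; move/negP: xD1; apply; have : [set` D1] x by rewrite -D1E.
have nS2 : ~ S2 x.
  by move=> Sx; move/negP: xD2; apply; have : [set` D2] x by rewrite -D2E.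
have [df1 dg1] := d1 _ lxr nS1; have [df2 dg2] := d2 _ lxr nS2.
apply: is_derive_eq; rewrite /GRing.scale/=; ring.
Qed.

Lemma solves_onB m e S l r f1 g1 f2 g2 :
  solves_on m e S l r f1 g1 -> solves_on m e S l r f2 g2 ->
  solves_on m e S l r (f1 - f2) (g1 - g2).
Proof.
move=> [cf1 cg1 d1] [cf2 cg2 d2].
split=> [x|x|x lxr Sx]; [exact: continuousB (cf1 x) (cf2 x)|
  exact: continuousB (cg1 x) (cg2 x)|].
have [df1 dg1] := d1 _ lxr Sx; have [df2 dg2] := d2 _ lxr Sx.
split.
  by rewrite -[(g1 - g2) x]/(g1 x - g2 x); apply: is_derive_eq; ring.
by rewrite -[(f1 - f2) x]/(f1 x - f2 x); apply: is_derive_eq; ring.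
Qed.

(** The function equal to [f] up to [p] and to [g] from [p] on, when
[f p = g p].  Clipping the argument by [min] and [max] instead of testing
[x < p] makes it a composition of continuous functions. *)
Definition glue p f g := fun x => f (Num.min x p) + (g (Num.max x p) - g p).

Lemma glue_le p f g x : x <= p -> glue p f g x = f x.
Proof. by move=> xp; rewrite /glue min_l// max_r// subrr addr0. Qed.

Lemma glue_ge p f g x : f p = g p -> p <= x -> glue p f g x = g x.
Proof. by move=> fg xp; rewrite /glue min_r// max_l// fg addrC subrK. Qed.

Lemma continuous_glue p f g : continuous f -> continuous g ->
  continuous (glue p f g).
Proof.
move=> cf cg x.
have cmin y : {for y, continuous (fun z : R => Num.min z p)}.
  by apply: (@continuous_min R R^o id (cst p)) => //; exact: cst_continuous.
have cmax y : {for y, continuous (fun z : R => Num.max z p)}.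
  by apply: (@continuous_max R R^o id (cst p)) => //; exact: cst_continuous.
apply: (@continuousD R R^o R^o (f \o fun z : R => Num.min z p)
  ((g \o fun z : R => Num.max z p) - cst (g p))).
  exact: continuous_comp (cmin x) (cf _).
apply: continuousB; last exact: cst_continuous.
exact: continuous_comp (cmax x) (cg _).
Qed.

Lemma solves_on_glue m e S l p r f1 g1 f2 g2 : S p ->
  solves_on m e S l p f1 g1 -> solves_on m e S p r f2 g2 ->
  f1 p = f2 p -> g1 p = g2 p ->
  solves_on m e S l r (glue p f1 f2) (glue p g1 g2).
Proof.
move=> Sp [cf1 cg1 d1] [cf2 cg2 d2] fp gp; split; [exact: continuous_glue..|].
move=> x /andP[lx xr] Sx.
have [xp|px|xp] := ltgtP x p; last by case: Sx; rewrite xp.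
  have [|df dg] := d1 x _ Sx; first by rewrite lx.
  rewrite !glue_le ?(ltW xp)//.
  by split; [apply: near_eq_is_derive df|apply: near_eq_is_derive dg];
    near=> y; rewrite glue_le// ltW//; near: y; exact: lt_nbhsl.
have [|df dg] := d2 x _ Sx; first by rewrite xr andbT.
rewrite !glue_ge ?(ltW px)//.
by split; [apply: near_eq_is_derive df|apply: near_eq_is_derive dg];
    near=> y; rewrite glue_ge// ltW//; near: y; exact: lt_nbhsr.
Unshelve. all: by end_near. Qed.

(** Every initial value problem with data at a point of the closed interval
[l, r] has a solution on it. *)
Definition solvable_on m e S l r := forall t (a b : R), l <= t <= r ->
  exists f g, [/\ f t = a, g t = b & solves_on m e S l r f g].

(** The solution is started in the interval that contains the initial point
and continued into the other one with its value at [p].  No derivative is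
needed at [p], since [p] is a break. *)
Lemma solvable_on_glue m e S l p r : l <= p <= r -> S p ->
  solvable_on m e S l p -> solvable_on m e S p r -> solvable_on m e S l r.
Proof.
move=> /andP[lp pr] Sp sl sr t a b /andP[lt tr].
have [tp|pt] := leP t p.
  have [|f1 [g1 [ft gt s1]]] := sl t a b; first by rewrite lt.
  have [|f2 [g2 [fp gp s2]]] := sr p (f1 p) (g1 p); first by rewrite lexx.
  exists (glue p f1 f2), (glue p g1 g2); rewrite !glue_le//.
  by split=> //; exact: solves_on_glue.
have [|f2 [g2 [ft gt s2]]] := sr t a b; first by rewrite (ltW pt).
have [|f1 [g1 [fp gp s1]]] := sl p (f2 p) (g2 p); first by rewrite lexx lp.
exists (glue p f1 f2), (glue p g1 g2); rewrite !glue_ge// ?(ltW pt)//.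
by split=> //; exact: solves_on_glue.
Qed.

(** Uniqueness.  The Wronskians of [(f, g)] with the two solutions of unit data
at [t] vanish, and the Wronskian of these two is [1]. *)
Lemma solves_on_zero m e S1 S2 l r t f g :
  finite_set (S1 `&` [set x | l < x < r]) ->
  finite_set (S2 `&` [set x | l < x < r]) ->
  solvable_on m e S2 l r -> l <= t <= r ->
  solves_on m e S1 l r f g -> f t = 0 -> g t = 0 ->
  forall x, l <= x <= r -> f x = 0 /\ g x = 0.
Proof.
move=> fin1 fin2 so ltr s ft gt x lxr.
have W f1 g1 f2 g2 T1 T2 : finite_set (T1 `&` [set x | l < x < r]) ->
    finite_set (T2 `&` [set x | l < x < r]) ->
    solves_on m e T1 l r f1 g1 ->
    solves_on m e T2 l r f2 g2 ->
    f1 t * g2 t - g1 t * f2 t = f1 x * g2 x - g1 x * f2 x.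
  move=> F1 F2 s1 s2; wlog tx : t x {ft gt} ltr lxr / t <= x.
    by move=> wl; have [/wl|/ltW/wl ->//] := leP t x; exact.
  have [/andP[lt _] /andP[_ xr]] := (ltr, lxr).
  have fs T : finite_set (T `&` [set x | l < x < r]) ->
      finite_set (T `&` [set y | t < y < x]).
    apply: sub_finite_set => y [Ty /andP[ty yx]]; split=> //=.
    by rewrite (le_lt_trans lt ty) (lt_le_trans yx xr).
  by apply: (wronskian_constant tx (fs _ F1) (fs _ F2));
    [exact: solves_on_sub lt xr s1|exact: solves_on_sub lt xr s2].
(* The Wronskian is [1] for the solutions with data [(1, 0)] and [(0, 1)]. *)
have [f1 [g1 [f1t g1t s1]]] := so t 1 0 ltr.
have [f2 [g2 [f2t g2t s2]]] := so t 0 1 ltr.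
have := W _ _ _ _ _ _ fin2 fin2 s1 s2.
have := W _ _ _ _ _ _ fin1 fin2 s s1.
have := W _ _ _ _ _ _ fin1 fin2 s s2.
rewrite ft gt f1t g1t f2t g2t !mul0r mulr1 !subr0.
move=> e2 e1 e0; split.
  transitivity (f x * (f1 x * g2 x - g1 x * f2 x)); first by rewrite -e0 mulr1.
  by rewrite [LHS](_ : _ = f1 x * (f x * g2 x - g x * f2 x)
     - f2 x * (f x * g1 x - g x * f1 x)); [rewrite -e2 -e1; ring|ring].
transitivity (g x * (f1 x * g2 x - g1 x * f2 x)); first by rewrite -e0 mulr1.
by rewrite [LHS](_ : _ = g1 x * (f x * g2 x - g x * f2 x)
     - g2 x * (f x * g1 x - g x * f1 x)); [rewrite -e2 -e1; ring|ring].
Qed.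

(** The solutions [C] and [S] of [y'' = - k y] with unit data at [0], for [k] of
any sign: the permittivities may be negative. *)
Lemma cos_sin_pair (k : R) : exists C S : R -> R, [/\ C 0 = 1, S 0 = 0,
  forall x, is_derive x 1 C (- (k * S x)) & forall x, is_derive x 1 S (C x)].
Proof.
have lin c x : is_derive x 1 (fun y : R => c * y) c.
  have := @is_deriveZ R R R id c x 1 1 (is_derive_id x 1).
  by rewrite /GRing.scale/= mulr1.
have [k0|k0|->] := ltgtP k 0.
(* [k < 0]: hyperbolic functions *)
- pose s := Num.sqrt (- k).
  have s0 : s != 0 by rewrite gt_eqF// sqrtr_gt0 oppr_gt0.
  have s2 : s * s = - k by rewrite -expr2 sqr_sqrtr// oppr_ge0 ltW.
  have dp x : is_derive x 1 (expR \o (fun y => s * y)) (expR (s * x) * s).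
    exact: (@is_derive1_comp R expR (fun y => s * y)).
  have dm x : is_derive x 1 (expR \o (fun y => - s * y)) (expR (- s * x) * - s).
    exact: (@is_derive1_comp R expR (fun y => - s * y)).
  exists (2^-1 \*: ((expR \o (fun y => s * y)) + (expR \o (fun y => - s * y)))).
  exists ((2^-1 / s) \*: ((expR \o (fun y => s * y)) - (expR \o (fun y => - s * y)))).
  split => /=.
  + rewrite ?fctE /GRing.scale/= !mulr0 expR0; by field.
  + by rewrite ?fctE /GRing.scale/= !mulr0 subrr mulr0.
  + move=> x; apply: is_derive_eq; rewrite /GRing.scale/=.
    have -> : k = - (s * s) by rewrite s2 opprK.
    rewrite ?fctE /GRing.scale/=; 
    by field; rewrite ?s0.
  + move=> x; apply: is_derive_eq; rewrite ?fctE /GRing.scale/=; 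
    by field; rewrite ?s0.
- pose s := Num.sqrt k.
  have s0 : s != 0 by rewrite gt_eqF// sqrtr_gt0.
  have s2 : s * s = k by rewrite -expr2 sqr_sqrtr// ltW.
  have dp x : is_derive x 1 (cos \o (fun y => s * y)) (- sin (s * x) * s).
    exact: (@is_derive1_comp R cos (fun y => s * y)).
  have dm x : is_derive x 1 (sin \o (fun y => s * y)) (cos (s * x) * s).
    exact: (@is_derive1_comp R sin (fun y => s * y)).
  exists (cos \o (fun y => s * y)), (s^-1 \*: (sin \o (fun y => s * y))).
  split => /=.
  + by rewrite mulr0 cos0.
  + by rewrite mulr0 sin0 /GRing.scale/= mulr0.
  + move=> x; apply: is_derive_eq; rewrite ?fctE /GRing.scale/= -s2; 
    by field; rewrite ?s0.
  + move=> x; apply: is_derive_eq; rewrite ?fctE /GRing.scale/=; 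
    by field; rewrite ?s0.
- exists (cst 1), id; split=> // x; last exact: is_derive_id.
  by apply: is_derive_eq; rewrite mul0r oppr0.
Qed.

Lemma solvable_on_const m e (c : R) S l r :
  (forall x, l < x < r -> e x = c) -> solvable_on m e S l r.
Proof.
move=> ec t a b ltr; have [C [Sn [C0 S0 dC dS]]] := cos_sin_pair (c * m).
pose sh := (id - cst t : R -> R).
have dsh x : is_derive x 1 sh 1 by apply: is_derive_eq; rewrite subr0.
have dC' x : is_derive x 1 (C \o sh) (- (c * m * Sn (sh x))).
  by rewrite -[X in is_derive _ _ _ X]mulr1; exact: is_derive1_comp.
have dS' x : is_derive x 1 (Sn \o sh) (C (sh x)).
  by rewrite -[X in is_derive _ _ _ X]mulr1; exact: is_derive1_comp.
pose f := (a \*: (C \o sh) + (b * c) \*: (Sn \o sh) : R -> R).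
pose g := (b \*: (C \o sh) + (- (m * a)) \*: (Sn \o sh) : R -> R).
have df x : is_derive x 1 f (c * g x).
  by apply: is_derive_eq; rewrite /f /g ?fctE /GRing.scale/= /GRing.scale/=; ring.
have dg x : is_derive x 1 g (- (m * f x)).
  by apply: is_derive_eq; rewrite /f /g ?fctE /GRing.scale/= /GRing.scale/=; ring.
have sh0 : sh t = 0 by rewrite /sh ?fctE subrr.
exists f, g; split.
- by rewrite /f ?fctE /GRing.scale/= /GRing.scale/= sh0 C0 S0; ring.
- by rewrite /g ?fctE /GRing.scale/= /GRing.scale/= sh0 C0 S0; ring.
split.
- by move=> x; apply/differentiable_continuous/derivable1_diffP; case: (df x).
- by move=> x; apply/differentiable_continuous/derivable1_diffP; case: (dg x).
- by move=> x lxr _; rewrite ec//.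
Qed.

End RealSystem.

(** * Solutions on the whole line *)

Section Global.
Context {R : realType}.
Implicit Types (f g e : R -> R) (S : set R) (l r m x t p : R).

Lemma solvable_on_sub m e S l r l' r' : l <= l' -> r' <= r ->
  solvable_on m e S l r -> solvable_on m e S l' r'.
Proof.
move=> ll rr so t a b /andP[lt tr].
have [|f [g [ft gt s]]] := so t a b; first by rewrite (le_trans ll) ?(le_trans tr).
by exists f, g; split => //; exact: solves_on_sub ll rr s.
Qed.

(** [S] has finitely many points in every bounded interval. *)
Definition locally_finite S :=
  forall l r, finite_set (S `&` [set x | l < x < r]).

(** A solution on the whole line, from solutions on bounded intervals: at [x]
it is the solution on a ball around [t] that contains [x]; by uniqueness the
choice of the ball does not matter. *)
Lemma solvable_global m e S t (a b : R) : locally_finite S ->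
  (forall l r, l <= r -> solvable_on m e S l r) ->
  exists f g, [/\ f t = a, g t = b & forall l r, solves_on m e S l r f g].
Proof.
move=> Sfin so.
pose rad (n : nat) : R := n.+1%:R.
have rad0 n : 0 < rad n by rewrite ltr0n.
have ex n : exists fg : (R -> R) * (R -> R),
    [/\ fg.1 t = a, fg.2 t = b & solves_on m e S (t - rad n) (t + rad n) fg.1 fg.2].
  have ltr : t - rad n <= t <= t + rad n.
    by have := rad0 n; lra.
  have [|f [g ?]] := so (t - rad n) (t + rad n) _ t a b ltr.
    by have := rad0 n; lra.
  by exists (f, g).
have [F HF] := choice ex.
(* Uniqueness on the smaller of two balls. *)
have agree n k x : (n <= k)%N -> `|x - t| <= rad n ->
    (F n).1 x = (F k).1 x /\ (F n).2 x = (F k).2 x.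
  move=> nk xn.
  have [fn gn sn] := HF n; have [fk gk sk] := HF k.
  have nkR : rad n <= rad k by rewrite ler_nat.
  have lr : t - rad n <= t + rad n by have := rad0 n; lra.
  have skn : solves_on m e S (t - rad n) (t + rad n) (F k).1 (F k).2.
    by apply: solves_on_sub sk; lra.
  have [] : ((F n).1 - (F k).1)%R x = 0 /\ ((F n).2 - (F k).2)%R x = 0.
    apply: (solves_on_zero (Sfin _ _) (Sfin _ _) (so _ _ lr) _ (solves_onB sn skn) (t := t)).
    - by have := rad0 n; lra.
    - by rewrite !fctE fn fk subrr.
    - by rewrite !fctE gn gk subrr.
    - by move: xn; rewrite ler_norml; lra.
  by rewrite !fctE => /eqP; rewrite subr_eq0 => /eqP -> /eqP; rewrite subr_eq0 => /eqP.
pose N x := Num.truncn `|x - t|.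
pose f x := (F (N x)).1 x; pose g x := (F (N x)).2 x.
have loc n x : `|x - t| < rad n -> f x = (F n).1 x /\ g x = (F n).2 x.
  move=> xn; have Nn : (N x <= n)%N by rewrite truncn_le_nat.
  by have := agree _ _ x Nn; apply; rewrite ltW// truncnS_gt.
have near_loc x : \forall y \near x, `|y - t| < rad (N x).
  have : `|x - t| < rad (N x) by exact: truncnS_gt.
  rewrite ltr_norml => /andP[h1 h2]; near=> y.
  have y1 : t - rad (N x) < y by near: y; apply: lt_nbhsr; lra.
  have y2 : y < t + rad (N x) by near: y; apply: lt_nbhsl; lra.
  by rewrite ltr_norml; lra.
have nf x : {near x, (F (N x)).1 =1 f}.
  by apply: filterS (near_loc x) => y yN; rewrite (loc _ _ yN).1.
have ng x : {near x, (F (N x)).2 =1 g}.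
  by apply: filterS (near_loc x) => y yN; rewrite (loc _ _ yN).2.
exists f, g; split; [by have [] := HF (N t)|by have [] := HF (N t)|].
move=> l r; split.
- move=> x; have [_ _ [cf _ _]] := HF (N x).
  exact: (cvg_trans (near_eq_cvg (nf x)) (cf x)).
- move=> x; have [_ _ [_ cg _]] := HF (N x).
  exact: (cvg_trans (near_eq_cvg (ng x)) (cg x)).
move=> x _ Sx; have [_ _ [_ _ /(_ x _ Sx)[]]] := HF (N x).
  have : `|x - t| < rad (N x) by exact: truncnS_gt.
  by rewrite ltr_norml; lra.
by move=> df dg; split;
  [apply: near_eq_is_derive df|apply: near_eq_is_derive dg].
Unshelve. all: by end_near. Qed.

End Global.

(** * The permittivity of one material *)

Section Cell.
Context {R : realType}.
Context (c : cell R) (eps1 eps2 : R -> R) (omega : R).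
Local Notation N := (npairs c).
Local Notation nd := (node c).
Local Notation perm := (fun x => permittivity c eps1 eps2 x omega).

Lemma node_mono i j : (i < j)%N -> (j <= N.*2.+1)%N -> nd i < nd j.
Proof.
elim: j => // j IH; rewrite ltnS leq_eqVlt => /predU1P[->|ij] jN.
  exact: node_incr.
by apply: (lt_trans (IH ij (ltnW jN))); exact: node_incr.
Qed.

Lemma node_bounds i : (0 < i < N.*2.+1)%N -> 0 < nd i < 1.
Proof.
move=> /andP[i0 iN]; rewrite -{1}(node_first c) -(node_last c).
by rewrite !node_mono// ltnW.
Qed.

Lemma fracpartD (n : int) (y : R) : 0 <= y < 1 -> fracpart (n%:~R + y) = y.
Proof.
move=> /andP[y0 y1]; rewrite /fracpart (@floor_def _ _ n); first by rewrite addrC addKr.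
by rewrite lerDl y0 intrD ltrD2l.
Qed.

Lemma fracpart_shift (n : int) (x : R) : fracpart (n%:~R + x) = fracpart x.
Proof.
have /andP[h1 h2] := floor_itv x.
rewrite -[in LHS](subrK (Num.floor x)%:~R x) addrA addrAC -intrD fracpartD//.
by move: h2; rewrite intrD; lra.
Qed.

Lemma fracpart_bounds (x : R) : 0 <= fracpart x < 1.
Proof. by have := floor_itv x; rewrite /fracpart intrD; lra. Qed.

Lemma permittivity_shift (n : int) x : perm (n%:~R + x) = perm x.
Proof. by rewrite /permittivity fracpart_shift. Qed.

Lemma permittivity_left x : fracpart x < nd 1 -> perm x = eps1 omega.
Proof.
move=> x1; rewrite /permittivity; case: existsP => // -[i /andP[ix _]].
have : nd i.*2.+1 < nd 1 by exact: lt_trans x1.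
rewrite lt_neqAle leNgt; case: (posnP i) => [->|i0]; first by rewrite eqxx.
by rewrite node_mono ?andbF//; have := ltn_ord i; lia.
Qed.

Lemma node_lt_index i j : (j <= N.*2.+1)%N -> (i <= N.*2.+1)%N -> nd i < nd j -> (i < j)%N.
Proof.
move=> jN iN ij; rewrite ltnNge leq_eqVlt; apply/negP => /predU1P[ji|ji].
  by move: ij; rewrite ji ltxx.
by move: ij; rewrite ltNge ltW// node_mono.
Qed.

(** [node i] and [node i.+1] bound an interval of [D^[2]] exactly when [i] is
odd. *)
Lemma permittivity_piece i x : (i < N.*2.+1)%N ->
  nd i < fracpart x < nd i.+1 ->
  perm x = if odd i then eps2 omega else eps1 omega.
Proof.
move=> iN /andP[ix xi]; rewrite /permittivity; case: existsP => [[k /andP[kx xk]]|H].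
  have kN := ltn_ord k.
  have : (k.*2.+1 < i.+1)%N by apply: node_lt_index (lt_trans kx xi); lia.
  have : (i < k.*2.+2)%N by apply: node_lt_index (lt_trans ix xk); lia.
  by move=> h1 h2; have -> : i = k.*2.+1; [lia|rewrite /= odd_double].
case: ifPn => // oi; case: H.
have iE : i = i./2.*2.+1 by lia.
have iN2 : (i./2 < N)%N by lia.
by exists (Ordinal iN2); rewrite /= -iE ix.
Qed.

Local Notation brk := (material_breaks c).

Lemma material_breaks_node (n : int) i : (0 < i < N.*2.+1)%N -> brk (n%:~R + nd i).
Proof.
move=> iN; exists i => //; rewrite fracpartD//.
by have /andP[? ->] := node_bounds iN; rewrite ltW.
Qed.

Lemma locally_finite_breaks : locally_finite brk.
Proof.
move=> l r.
pose K := `|Num.floor r - Num.floor l|.+1%N.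
have : finite_set [set (Num.floor l + k%:Z)%:~R + nd i | k in `I_K & i in `I_(N.*2.+1)].
  by apply: finite_image2; exact: finite_II.
apply: sub_finite_set => x [[i /andP[i0 iN] xi]] /andP[lx xr].
have lf : Num.floor l <= Num.floor x by rewrite le_floor ?ltW.
have fr : Num.floor x <= Num.floor r by rewrite le_floor ?ltW.
exists `|Num.floor x - Num.floor l|%N; first by rewrite /=/K; lia.
exists i => //; rewrite -xi /fracpart.
have -> : Num.floor l + `|Num.floor x - Num.floor l|%N = Num.floor x by lia.
by rewrite addrC subrK.
Qed.

Lemma integer_not_break (n : int) : ~ brk n%:~R.
Proof.
move=> [i iN]; rewrite -[n%:~R]addr0 fracpartD ?lexx ?ltr01// => i0.
by have := node_bounds iN; rewrite -i0 ltxx.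
Qed.

Lemma permittivity_integer (n : int) : perm n%:~R = eps1 omega.
Proof.
apply: permittivity_left; rewrite -[n%:~R]addr0 fracpartD ?lexx ?ltr01//.
by rewrite -(node_first c) node_mono.
Qed.

Lemma solvable_piece m (n : int) i : (0 < i < N.*2)%N ->
  solvable_on m perm brk (n%:~R + nd i) (n%:~R + nd i.+1).
Proof.
move=> /andP[i0 iN]; apply: (@solvable_on_const _ _ _ (if odd i then eps2 omega else eps1 omega)).
move=> x /andP[ix xi]; apply: permittivity_piece; first by lia.
have /andP[? ?] : 0 < nd i < 1 by apply: node_bounds; lia.
have /andP[? ?] : 0 < nd i.+1 < 1 by apply: node_bounds; lia.
rewrite -[x](subrK n%:~R) [_ + n%:~R]addrC fracpartD; last by lra.
by apply/andP; split; lra.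
Qed.

(** The last interval [D^[1]] of a cell and the first one of the next cell form
a single interval with constant permittivity, around [n + 1]. *)
Lemma solvable_across_integer m (n : int) :
  solvable_on m perm brk (n%:~R + nd N.*2) ((n + 1)%:~R + nd 1).
Proof.
have N0 := npairs_gt0 c.
have /andP[? ?] : 0 < nd 1 < 1 by apply: node_bounds; lia.
have /andP[? ?] : 0 < nd N.*2 < 1 by apply: node_bounds; lia.
apply: (@solvable_on_const _ _ _ (eps1 omega)) => x /andP[ix xi].
have [xn|nx] := ltP x (n + 1)%:~R; move: xi; rewrite intrD => xi.
  move: xn; rewrite intrD => xn.
  rewrite (@permittivity_piece N.*2) ?odd_double// node_last.
  rewrite -[x](subrK n%:~R) [_ + n%:~R]addrC fracpartD; last by lra.
  by apply/andP; split; lra.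
move: nx; rewrite intrD => nx.
apply: permittivity_left; rewrite -[x](subrK (n + 1)%:~R) [_ + (n+1)%:~R]addrC.
by rewrite fracpartD intrD; lra.
Qed.

(** The period starts at [n + node 1] rather than at [n], so that solutions are
glued at breaks only. *)
Lemma solvable_period m (n : int) :
  solvable_on m perm brk (n%:~R + nd 1) ((n + 1)%:~R + nd 1).
Proof.
have N0 := npairs_gt0 c.
have H i : (i < N.*2)%N -> solvable_on m perm brk (n%:~R + nd 1) (n%:~R + nd i.+1).
  elim: i => [_|i IH iN].
    (* The interval is a point: any constant will do. *)
    by apply: (@solvable_on_const _ _ _ 0) => x; lra.
  apply: (@solvable_on_glue _ _ _ _ _ (n%:~R + nd i.+1)).
  - rewrite !lerD2l (ltW (node_incr _)) ?andbT; last by lia.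
    by case: i {IH iN} (iN) => // i iN; rewrite ltW// node_mono//; lia.
  - by apply: material_breaks_node; lia.
  - by apply: IH; lia.
  - by apply: solvable_piece; lia.
apply: (@solvable_on_glue _ _ _ _ _ (n%:~R + nd N.*2)).
- rewrite intrD -addrA !lerD2l; apply/andP; split.
    by rewrite ltW// node_mono//; lia.
  have /andP[? ?] : 0 < nd 1 < 1 by apply: node_bounds; lia.
  have /andP[? ?] : 0 < nd N.*2 < 1 by apply: node_bounds; lia.
  by lra.
- by apply: material_breaks_node; lia.
- by rewrite -(prednK (_ : 0 < N.*2)%N); [apply: H; lia|lia].
- exact: solvable_across_integer.
Qed.

Lemma solvable_permittivity m l r : l <= r -> solvable_on m perm brk l r.
Proof.
move=> lr; have N0 := npairs_gt0 c.
have b1 (n : int) : brk (n%:~R + nd 1) by apply: material_breaks_node; lia.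
have H (k : nat) : solvable_on m perm brk ((- k%:Z)%:~R + nd 1) (k%:Z%:~R + nd 1).
  elim: k => [|k IH]; first by apply: (@solvable_on_const _ _ _ 0) => x; lra.
  have E : - k%:Z = - k.+1%:Z + 1 :> int by lia.
  have E' : k.+1%:Z = k%:Z + 1 :> int by lia.
  apply: (@solvable_on_glue _ _ _ _ _ ((- k%:Z)%:~R + nd 1)) => //.
  - by rewrite !lerD2r !ler_int; lia.
  - by rewrite E; exact: solvable_period.
  apply: (@solvable_on_glue _ _ _ _ _ (k%:Z%:~R + nd 1)) => //.
  - by rewrite !lerD2r !ler_int; lia.
  - by rewrite E'; exact: solvable_period.
have /andP[? ?] : 0 < nd 1 < 1 by apply: node_bounds; lia.
pose k := (Num.truncn (`|l| + `|r|)).+1.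
have : `|l| + `|r| < k%:R by exact: truncnS_gt.
have := ler_norm r; have := ler_norm (- l); rewrite normrN => h1 h2 h3.
have := normr_ge0 r; have := normr_ge0 l => h4 h5.
have : k.+1%:R = k%:R + 1 :> R by rewrite -natr1.
move=> kE; apply: solvable_on_sub (H k.+1); rewrite ?mulrNz -?pmulrn kE; lra.
Qed.

(** Mirror symmetry of the cell and periodicity. *)
Lemma permittivity_even x : mirror_symmetric c eps1 eps2 omega ->
  perm (- x) = perm x.
Proof.
move=> mir; have /andP[y0 y1] := fracpart_bounds x.
have xE : x = (Num.floor x)%:~R + fracpart x by rewrite /fracpart addrC subrK.
have -> : - x = (- Num.floor x - 1)%:~R + (1 - fracpart x).
  by rewrite {1}xE intrB mulrNz; lra.
rewrite [in RHS]xE !permittivity_shift -mir//.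
by rewrite y0 ltW.
Qed.

End Cell.

(** * Complex-valued functions *)

Section Complex.
Local Open Scope complex_scope.
Context {R : realType}.
Local Notation C := R[i].
(* Real and imaginary parts in [R], not those of a closed field in [C]. *)
Local Notation Re := complex.Re.
Local Notation Im := complex.Im.

Lemma normc_ge_Im (z : C) : `|Im z|%:C <= `|z|.
Proof.
by rewrite normc_def lecR -sqrtr_sqr ler_wsqrtr// lerDr sqr_ge0.
Qed.

Lemma normc_le_ReIm (z : C) : `|z| <= (`|Re z| + `|Im z|)%:C.
Proof.
rewrite normc_def lecR -[leRHS]ger0_norm ?addr_ge0// -sqrtr_sqr ler_wsqrtr//.
rewrite sqrrD !real_normK ?num_real// addrAC lerDl.
by rewrite mulrn_wge0// mulr_ge0.
Qed.

Lemma cvg_complex (T : Type) (F : set_system T) (FF : Filter F) (u : T -> C) (z : C) :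
  ((u x : C^o) @[x --> F] --> (z : C^o)) <->
  (Re (u x) @[x --> F] --> Re z) /\ (Im (u x) @[x --> F] --> Im z).
Proof.
split=> [/cvgrPdist_lt uz|[/cvgrPdist_lt ru /cvgrPdist_lt iu]].
  split; apply/cvgrPdist_lt => eps eps0.
    have e0 : 0 < eps%:C :> C by rewrite ltcR.
    apply: filterS (uz _ e0) => x; rewrite -ltcR; apply: le_lt_trans.
    by rewrite -raddfB; exact: normc_ge_Re.
  have e0 : 0 < eps%:C :> C by rewrite ltcR.
  apply: filterS (uz _ e0) => x; rewrite -ltcR; apply: le_lt_trans.
  by rewrite -raddfB; exact: normc_ge_Im.
apply/cvgrPdist_lt => -[e e']; rewrite ltcE/= => /andP[/eqP -> e0].
have e20 : 0 < e / 2 by rewrite divr_gt0.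
near=> x; apply: (le_lt_trans (normc_le_ReIm _)).
rewrite -[e +i* 0]/(e%:C) ltcR [ltRHS](splitr e) !raddfB ltrD//.
  by near: x; exact: ru.
by near: x; exact: iu.
Unshelve. all: by end_near. Qed.

(** The real derivative in terms of the difference quotient of
[cquotient]. *)
Lemma is_derive_quotient (f : R -> R) (x d : R) :
  is_derive x 1 f d <-> h^-1 * (f (x + h) - f x) @[h --> 0^'] --> d.
Proof.
have -> : (fun h => h^-1 * (f (x + h) - f x)) =
          (fun h => h^-1 *: ((f \o shift x) (h *: 1) - f x)).
  by apply/funext => h; rewrite /= [h *: 1]mulr1 [h + x]addrC.
split => [[dfx <-]|fd]; first exact: dfx.
have cv : cvg (h^-1 *: ((f \o shift x) (h *: (1 : R)) - f x) @[h --> 0^']).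
  by apply/cvg_ex; exists d.
by apply: DeriveDef => //; exact: cvg_lim fd.
Qed.

Lemma cquotient_cvg (u : R -> C) (x : R) (d : C) :
  (cquotient u x h @[h --> 0^'] --> (d : C^o)) <->
  is_derive x 1 (fun y => Re (u y)) (Re d) /\ is_derive x 1 (fun y => Im (u y)) (Im d).
Proof.
rewrite !is_derive_quotient.
have -> : (fun h => h^-1 * (Re (u (x + h)) - Re (u x))) = (fun h => Re (cquotient u x h)).
  apply/funext => h; rewrite /cquotient.
  by case: (u (x + h)) => a b; case: (u x) => a' b' /=; rewrite mul0r subr0.
have -> : (fun h => h^-1 * (Im (u (x + h)) - Im (u x))) = (fun h => Im (cquotient u x h)).
  apply/funext => h; rewrite /cquotient.
  by case: (u (x + h)) => a b; case: (u x) => a' b' /=; rewrite mul0r addr0.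
exact: cvg_complex.
Qed.

Lemma cderiv_is_derive (u : R -> C) (x : R) : cderivable u x ->
  is_derive x 1 (fun y => Re (u y)) (Re (cderiv u x)) /\
  is_derive x 1 (fun y => Im (u y)) (Im (cderiv u x)).
Proof. by move=> du; apply/cquotient_cvg. Qed.

Lemma is_derive_cderiv (u : R -> C) (x : R) (d : C) :
  is_derive x 1 (fun y => Re (u y)) (Re d) ->
  is_derive x 1 (fun y => Im (u y)) (Im d) ->
  cderivable u x /\ cderiv u x = d.
Proof.
move=> rd id; have ud : cquotient u x h @[h --> 0^'] --> (d : C^o) by apply/cquotient_cvg.
split; first by apply/cvg_ex; exists d.
exact: (cvg_lim (@norm_hausdorff _ _) ud).
Qed.

Lemma ccontinuous_ReIm (u : R -> C) : ccontinuous u <->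
  continuous (fun x => Re (u x)) /\ continuous (fun x => Im (u x)).
Proof.
split=> [cu|[ru iu] x]; last by apply/cvg_complex; split; [exact: ru|exact: iu].
by split=> x; have /cvg_complex[] := cu x.
Qed.

(** The real and the imaginary parts of the complex functions [u] and [w] solve
the first order system. *)
Definition csolves_on m e S l r (u w : R -> C) :=
  solves_on m e S l r (fun x => Re (u x)) (fun x => Re (w x)) /\
  solves_on m e S l r (fun x => Im (u x)) (fun x => Im (w x)).

Lemma csolves_on_helmholtz mu0 (e : R -> R) S omega (u : R -> C) :
  mu0 != 0 -> (forall x, ~ S x -> e x != 0) ->
  helmholtz_solution mu0 e S omega u ->
  exists w : R -> C, (forall x, ~ S x -> cderiv u x = (e x)%:C * w x) /\
    forall l r, csolves_on (mu0 * omega ^+ 2) e S l r u w.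
Proof.
move=> mu0n e0 [/ccontinuous_ReIm[cru ciu] [w /ccontinuous_ReIm[crw ciw] uw]].
exists w.
have uE x : ~ S x -> cderiv u x = (e x)%:C * w x.
  move=> Sx; have [_ -> _ _] := uw x Sx.
  by rewrite mulrA -rmorphM/= divff ?mul1r// e0.
split=> // l r.
have wE x : ~ S x -> cderiv w x = - (mu0 * omega ^+ 2)%:C * u x.
  move=> Sx; have [_ _ _ H] := uw x Sx.
  rewrite rmorphM -mulNr -mulrA/= -H mulrA mulrNN -rmorphM/=.
  by rewrite divff// mul1r.
split; split=> // x _ Sx; have [/cderiv_is_derive[du1 du2] _ /cderiv_is_derive[dw1 dw2] _] := uw x Sx.
  split.
    apply: is_derive_eq du1 _; rewrite uE//; case: (w x) => a b /=; ring.
  apply: is_derive_eq dw1 _; rewrite wE//; case: (u x) => a b /=; ring.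
split.
  apply: is_derive_eq du2 _; rewrite uE//; case: (w x) => a b /=; ring.
apply: is_derive_eq dw2 _; rewrite wE//; case: (u x) => a b /=; ring.
Qed.

(** Conversely, a complex solution of the first order system solves the
Helmholtz problem. *)
Lemma helmholtz_csolves_on mu0 (e : R -> R) S omega (u w : R -> C) :
  mu0 != 0 -> (forall x, ~ S x -> e x != 0) ->
  (forall l r, csolves_on (mu0 * omega ^+ 2) e S l r u w) ->
  helmholtz_solution mu0 e S omega u /\
  forall x, ~ S x -> cderiv u x = (e x)%:C * w x.
Proof.
move=> mu0n e0 s.
have [[cru crw _] [ciu ciw _]] := s 0 0.
have D x : ~ S x ->
    [/\ cderivable u x, cderiv u x = (e x)%:C * w x, cderivable w x &
      cderiv w x = - (mu0 * omega ^+ 2)%:C * u x].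
  move=> Sx; have xI : x - 1 < x < x + 1 by lra.
  have [[_ _ /(_ x xI Sx)[ru rw]] [_ _ /(_ x xI Sx)[iu iw]]] := s (x - 1) (x + 1).
  have [? ?] : cderivable u x /\ cderiv u x = (e x)%:C * w x.
    apply: is_derive_cderiv; [apply: is_derive_eq ru _|apply: is_derive_eq iu _];
      case: (w x) => a b /=; ring.
  have [? ?] : cderivable w x /\ cderiv w x = - (mu0 * omega ^+ 2)%:C * u x.
    apply: is_derive_cderiv; [apply: is_derive_eq rw _|apply: is_derive_eq iw _];
      case: (u x) => a b /=; ring.
  by split.
split; last by move=> x /D[].
split; first exact/ccontinuous_ReIm.
exists w; first exact/ccontinuous_ReIm.
move=> x Sx; have [du duE dw dwE] := D x Sx; split=> //.
  by rewrite duE mulrA -rmorphM/= mulVf ?mul1r// e0.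
rewrite dwE mulrA mulrNN -rmorphM/= mulrA mulVf// mul1r.
by [].
Qed.

Lemma cwronskian_constant m e S1 S2 l r (u1 w1 u2 w2 : R -> C) : l <= r ->
  locally_finite S1 -> locally_finite S2 ->
  csolves_on m e S1 l r u1 w1 -> csolves_on m e S2 l r u2 w2 ->
  u1 l * w2 l - w1 l * u2 l = u1 r * w2 r - w1 r * u2 r.
Proof.
move=> lr fin1 fin2 [s1 t1] [s2 t2].
have := wronskian_constant lr (fin1 _ _) (fin2 _ _) s1 s2.
have := wronskian_constant lr (fin1 _ _) (fin2 _ _) s1 t2.
have := wronskian_constant lr (fin1 _ _) (fin2 _ _) t1 s2.
have := wronskian_constant lr (fin1 _ _) (fin2 _ _) t1 t2.
case: (u1 l) (w1 l) (u2 l) (w2 l) => [? ?] [? ?] [? ?] [? ?] /=.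
case: (u1 r) (w1 r) (u2 r) (w2 r) => [? ?] [? ?] [? ?] [? ?] /=.
move=> h1 h2 h3 h4; apply/eqP; rewrite eq_complex/=; apply/andP; split; apply/eqP; lra.
Qed.

(** The bound is required for [0 < n] only: [0] is a break of the full
structure, where the equation does not give the derivative of the mode. *)
Lemma vanishing_bound (z1 z2 : nat -> C) (W a b : C) :
  cvanishes z1 -> cvanishes z2 ->
  (forall n, (0 < n)%N -> `|W| <= `|z1 n| * `|a| + `|z2 n| * `|b|) -> W = 0.
Proof.
move=> /cvgrPdist_lt z10 /cvgrPdist_lt z20 H.
apply/eqP; apply/negP => /negP W0.
pose d : C := `|a| + `|b| + 1.
have d0 : 0 < d by rewrite ltr_wpDl// addr_ge0.
have e0 : 0 < `|W| / d by rewrite divr_gt0 ?normr_gt0.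
have [n [n0 h1 h2]] : exists n, [/\ (0 < n)%N, `|z1 n| < `|W| / d & `|z2 n| < `|W| / d].
  near \oo => n; exists n; split.
  - by near: n; exists 1%N.
  - by rewrite -normrN -sub0r; near: n; exact: z10.
  - by rewrite -normrN -sub0r; near: n; exact: z20.
have := H n n0; apply/negP; rewrite lt_geF//.
apply: (@le_lt_trans _ _ (`|W| / d * (`|a| + `|b|))).
  by rewrite mulrDr lerD// ler_wpM2r// ltW.
rewrite -[ltRHS](divfK (lt0r_neq0 d0)) ltr_pM2l//.
by rewrite /d ltrDl.
Unshelve. all: by end_near. Qed.

End Complex.

(** * Decaying solutions and eigenvectors *)

Section Main.
Local Open Scope complex_scope.
Context {R : realType}.
Local Notation C := R[i].
(* Real and imaginary parts in [R], not those of a closed field in [C]. *)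
Local Notation Re := complex.Re.
Local Notation Im := complex.Im.

Lemma permittivity_neq0 (c : cell R) (eps1 eps2 : R -> R) omega x :
  eps1 omega != 0 -> eps2 omega != 0 -> permittivity c eps1 eps2 x omega != 0.
Proof. by move=> e1 e2; rewrite /permittivity; case: ifP. Qed.

Lemma material_solution_exists (mu0 : R) (c : cell R) (eps1 eps2 : R -> R) omega (a b : C) :
  mu0 != 0 -> eps1 omega != 0 -> eps2 omega != 0 ->
  exists v w : R -> C, [/\ v 0 = a, w 0 = b,
    material_solution mu0 c eps1 eps2 omega v,
    forall x, ~ material_breaks c x ->
      cderiv v x = (permittivity c eps1 eps2 x omega)%:C * w x &
    forall l r, csolves_on (mu0 * omega ^+ 2)
      (fun x => permittivity c eps1 eps2 x omega) (material_breaks c) l r v w].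
Proof.
move=> mu0n e1 e2; set m := mu0 * _; set e := fun x => permittivity _ _ _ x _.
have ex a0 b0 := solvable_global 0 a0 b0 (@locally_finite_breaks R c)
  (fun l r => @solvable_permittivity R c eps1 eps2 omega m l r).
have [f1 [g1 [f10 g10 s1]]] := ex (Re a) (Re b).
have [f2 [g2 [f20 g20 s2]]] := ex (Im a) (Im b).
have s l r : csolves_on m e (material_breaks c) l r
    (fun x => f1 x +i* f2 x) (fun x => g1 x +i* g2 x) by split.
have [x _|sol dv] := helmholtz_csolves_on mu0n _ s.
  exact: permittivity_neq0.
exists (fun x => f1 x +i* f2 x), (fun x => g1 x +i* g2 x); split=> //.
  by rewrite f10 f20; case: (a).
by rewrite g10 g20; case: (b).
Qed.

Lemma col2_eqP (a b : C) (V : 'cV[C]_2) : col2 a b = V <-> a = V 0 0 /\ b = V 1 0.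
Proof.
split=> [<-|[-> ->]]; first by rewrite !mxE/=.
apply/colP => i; rewrite !mxE; case: eqVneq => [->//|].
by case: i => -[|[|//]] i //= _; congr (V _ _); exact: val_inj.
Qed.

(** The states at the integers of the solution that starts from an
eigenvector. *)
Lemma transfer_iterate (mu0 : R) (c : cell R) (eps1 eps2 : R -> R) omega
    (T : 'M[C]_2) lambda (V : 'cV[C]_2) (v : R -> C) :
  is_transfer_matrix mu0 c eps1 eps2 omega T -> is_eigenvector T lambda V ->
  material_solution mu0 c eps1 eps2 omega v -> state v 0 = V ->
  forall n : nat, state v n%:R = lambda ^+ n *: V.
Proof.
move=> tT [_ TV] vsol v0; elim=> [|n IH]; first by rewrite v0 scale1r.
have := tT v vsol n%:Z.
have -> : (n%:Z + 1)%:~R = n.+1%:R :> R by rewrite intrD -natr1.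
rewrite -pmulrn => ->; rewrite IH -scalemxAr TV scalerA exprSr.
by [].
Qed.

(** A solution on the half line [0 <= x] that tends to zero along the integers,
together with its derivative, has at [0] a state parallel to the eigenvector
[V] of an eigenvalue of modulus less than [1].  The derivative at [0] is expressed by [w 0], and [y n] stands for the
derivative at [n], for [0 < n]. *)
Lemma eigenmode_state_parallel (mu0 : R) (c : cell R) (eps1 eps2 : R -> R) omega
    (T : 'M[C]_2) lambda (V : 'cV[C]_2) S (u w : R -> C) (y : nat -> C) :
  mu0 != 0 -> eps1 omega != 0 -> eps2 omega != 0 ->
  is_transfer_matrix mu0 c eps1 eps2 omega T -> is_eigenvector T lambda V ->
  `|lambda| < 1 -> locally_finite S ->
  (forall r, csolves_on (mu0 * omega ^+ 2)
     (fun x => permittivity c eps1 eps2 x omega) S 0 r u w) ->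
  cvanishes (fun n => u n%:R) -> cvanishes y ->
  (forall n, (0 < n)%N -> y n = (eps1 omega)%:C * w n%:R) ->
  u 0 * V 1 0 = (eps1 omega)%:C * w 0 * V 0 0.
Proof.
move=> mu0n e1 e2 tT eV lam1 Sfin us u0 y0 yE.
have e1C : (eps1 omega)%:C != 0 by rewrite -(inj_eq (@complexI R)) in e1.
have [v [z [v0 z0 vsol dv vs]]] := @material_solution_exists mu0 c eps1 eps2 omega
  (V 0 0) ((eps1 omega)%:C^-1 * V 1 0) mu0n e1 e2.
have dvn (n : nat) : cderiv v n%:R = (eps1 omega)%:C * z n%:R.
  rewrite dv; first by rewrite pmulrn permittivity_integer.
  by rewrite pmulrn; exact: integer_not_break.
have st0 : state v 0 = V.
  by apply/col2_eqP; rewrite v0 (dvn 0) z0 mulVKf.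
have stn n : v n%:R = lambda ^+ n * V 0 0 /\ (eps1 omega)%:C * z n%:R = lambda ^+ n * V 1 0.
  have /col2_eqP[] := transfer_iterate tT eV vsol st0 n.
  by rewrite !mxE dvn.
have W n := cwronskian_constant (ler0n R n) Sfin (@locally_finite_breaks R c)
  (us n%:R) (vs 0 n%:R).
apply/eqP; rewrite -subr_eq0; apply/eqP.
apply: (@vanishing_bound R _ _ _ (V 1 0) (V 0 0) u0 y0) => n n0.
(* The left-hand side is [eps1] times the Wronskian at [0], hence at [n]. *)
have -> : u 0 * V 1 0 - (eps1 omega)%:C * w 0 * V 0 0 =
    lambda ^+ n * (u n%:R * V 1 0 - y n * V 0 0).
  have [vn zn] := stn n; rewrite yE//.
  transitivity ((eps1 omega)%:C * (u 0 * z 0 - w 0 * v 0)).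
    by rewrite v0 z0; field.
  rewrite (W n) vn [LHS](_ : _ = u n%:R * ((eps1 omega)%:C * z n%:R)
     - (eps1 omega)%:C * w n%:R * (lambda ^+ n * V 0 0)); last by ring.
  by rewrite zn; ring.
rewrite normrM -[leRHS]mul1r ler_pM//.
  by rewrite normrX exprn_ile1// ltW.
by rewrite (le_trans (ler_normB _ _))// !normrM.
Qed.

(** The reflection [x |-> - x] changes the sign of the derivative, hence of the
second component. *)
Lemma solves_on_reflect m e S l r (f g : R -> R) :
  solves_on m e S l r f g ->
  solves_on m (fun x => e (- x)) [set x | S (- x)] (- r) (- l) (f \o -%R) (- (g \o -%R)).
Proof.
move=> [cf cg d]; split.
- by move=> x; apply: continuous_comp; [exact: opp_continuous|exact: cf].
- by move=> x; apply: continuousN; apply: continuous_comp; [exact: opp_continuous|exact: cg].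
move=> x lxr Sx; have [|df dg] := d (- x) _ Sx; first by lra.
have dN : is_derive x 1 (-%R : R -> R) (-1) by exact: is_deriveNid.
have := @is_derive1_comp R f -%R x _ _ df dN.
have := @is_derive1_comp R g -%R x _ _ dg dN => dg' df'.
split; first by apply: is_derive_eq df' _; rewrite fctE/=; ring.
by apply: is_derive_eq; rewrite /=; ring.
Qed.

Lemma csolves_on_reflect m e S l r (u w : R -> C) :
  csolves_on m e S l r u w ->
  csolves_on m (fun x => e (- x)) [set x | S (- x)] (- r) (- l)
   (fun x => u (- x)) (fun x => - w (- x)).
Proof.
move=> [/solves_on_reflect s1 /solves_on_reflect s2]; split.
  rewrite (_ : (fun x => Re (- w (- x))) = - ((fun x => Re (w x)) \o -%R)) //.
  by apply/funext => x /=; rewrite !fctE/=; case: (w _).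
rewrite (_ : (fun x => Im (- w (- x))) = - ((fun x => Im (w x)) \o -%R)) //.
by apply/funext => x /=; rewrite !fctE/=; case: (w _).
Qed.

Lemma locally_finite_opp (S : set R) : locally_finite S -> locally_finite [set x | S (- x)].
Proof.
move=> Sfin l r; have := finite_image -%R (Sfin (- r) (- l)).
apply: sub_finite_set => x [Sx /= lxr]; exists (- x); last by rewrite opprK.
by split=> //=; lra.
Qed.

(** Only the coefficient and the breaks strictly between [l] and [r]
matter. *)
Lemma csolves_on_local m e e' S S' l r (u w : R -> C) :
  (forall x, l < x < r -> e x = e' x /\ (S x -> S' x)) ->
  csolves_on m e S l r u w -> csolves_on m e' S' l r u w.
Proof.
move=> ee [[cf cg d] [cf' cg' d']]; split; split=> // x lxr Sx;
  have [<- SS] := ee _ lxr; (apply: d || apply: d') => //; exact/contra_not/Sx.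
Qed.

Lemma csolves_on_zero m (c : cell R) (eps1 eps2 : R -> R) omega S r (u w : R -> C) :
  locally_finite S -> 0 <= r ->
  csolves_on m (fun x => permittivity c eps1 eps2 x omega) S 0 r u w ->
  u 0 = 0 -> w 0 = 0 -> u r = 0.
Proof.
move=> Sfin r0 [s1 s2] u0 w0.
have so := @solvable_permittivity R c eps1 eps2 omega m 0 r r0.
have i0 : 0 <= (0 : R) <= r by rewrite lexx.
have ir : 0 <= r <= r by rewrite lexx r0.
have [] := solves_on_zero (Sfin _ _) (@locally_finite_breaks R c _ _) so i0 s1 _ _ ir; rewrite ?u0 ?w0//.
have [] := solves_on_zero (Sfin _ _) (@locally_finite_breaks R c _ _) so i0 s2 _ _ ir; rewrite ?u0 ?w0//.
by case: (u r) => a b /= -> _ -> _.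
Qed.

End Main.

Theorem theorem5p2 (R : realType) (mu0 : R) (eps1 eps2 : R -> R)
    (Freq : set R) (A B : cell R) (omega : R) (u : R -> R[i])
    (TA TB : 'M[R[i]]_2) (lambdaA lambdaB : R[i]) (VA VB : 'cV[R[i]]_2)
    (mu0_gt0 : 0 < mu0)
    (eps1_cont : {within Freq, continuous eps1})
    (eps2_cont : {within Freq, continuous eps2})
    (eps1_neq0 : forall w, Freq w -> eps1 w != 0)
    (eps2_neq0 : forall w, Freq w -> eps2 w != 0)
    (A_mirror : forall w, Freq w -> mirror_symmetric A eps1 eps2 w)
    (B_mirror : forall w, Freq w -> mirror_symmetric B eps1 eps2 w)
    (omega_Freq : Freq omega)
    (u_mode : localised_eigenmode mu0 A B eps1 eps2 omega u)
    (TA_transfer : is_transfer_matrix mu0 A eps1 eps2 omega TA)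
    (TB_transfer : is_transfer_matrix mu0 B eps1 eps2 omega TB)
    (VA_eigen : is_eigenvector TA lambdaA VA)
    (lambdaA_lt1 : `|lambdaA| < 1)
    (VB_eigen : is_eigenvector TB lambdaB VB)
    (lambdaB_lt1 : `|lambdaB| < 1) :
  row2 (- VB 1 0) (VB 0 0) *m col2 (VA 0 0) (- VA 1 0) = 0.
Proof.
have mu0n : mu0 != 0 by rewrite gt_eqF.
have e1 := eps1_neq0 _ omega_Freq; have e2 := eps2_neq0 _ omega_Freq.
have [ufull [x0 ux0] [uB duB] [uA duA]] := u_mode.
have [x _|w [dw us]] := csolves_on_helmholtz mu0n _ ufull.
  by rewrite /full_permittivity; case: ifP => _; exact: permittivity_neq0.
(* On each half line the full structure is one of the two materials. *)
have usB r : csolves_on (mu0 * omega ^+ 2) (fun x => permittivity B eps1 eps2 x omega)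
    (material_breaks B) 0 r u w.
  apply: csolves_on_local (us 0 r) => x /andP[x_gt0 _].
  rewrite /full_permittivity ltNge (ltW x_gt0); split=> // -[[x_lt0 _]|x0'|[]//].
    by move: x_lt0; rewrite ltNge ltW.
  by move: x_gt0; rewrite x0' ltxx.
have usA r : csolves_on (mu0 * omega ^+ 2) (fun x => permittivity A eps1 eps2 x omega)
    [set x | material_breaks A (- x)] 0 r (fun x => u (- x)) (fun x => - w (- x)).
  have := csolves_on_reflect (us (- r) 0); rewrite opprK oppr0.
  apply: csolves_on_local => x /andP[x_gt0 _].
  rewrite /full_permittivity oppr_lt0 x_gt0 permittivity_even; last exact: A_mirror.
  split=> // -[[]//|x0'|[x_lt0 _]].
    by move/eqP: x0'; rewrite oppr_eq0 (gt_eqF x_gt0).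
  by move: x_lt0; rewrite oppr_gt0 ltNge ltW.
have fA := locally_finite_opp (@locally_finite_breaks R A).
have fB := @locally_finite_breaks R B.
have HB : u 0 * VB 1 0 = (eps1 omega)%:C%C * w 0 * VB 0 0.
  apply: (eigenmode_state_parallel mu0n e1 e2 TB_transfer VB_eigen lambdaB_lt1 fB usB uB duB).
  move=> n n0; have n0' : 0 < n%:R :> R by rewrite ltr0n.
  rewrite dw; first by rewrite /full_permittivity ltNge (ltW n0') /= pmulrn permittivity_integer.
  case=> [[]|nE|[_]]; first by rewrite ltNge ltW.
    by rewrite nE ltxx in n0'.
  by rewrite pmulrn => /integer_not_break.
have HA : u 0 * VA 1 0 = - ((eps1 omega)%:C%C * w 0) * VA 0 0.
  (* The derivative of [x |-> u (- x)] at [n]. *)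
  have duA' : cvanishes (fun n => - cderiv u (- n%:R)).
    by rewrite /cvanishes -[X in _ --> X]oppr0; exact: cvgN.
  have := eigenmode_state_parallel mu0n e1 e2 TA_transfer VA_eigen lambdaA_lt1 fA usA uA duA'.
  rewrite oppr0 mulrN; apply => n n0; have n0' : 0 < n%:R :> R by rewrite ltr0n.
  rewrite dw ?mulrN; first by rewrite /full_permittivity oppr_lt0 n0' pmulrn -mulrNz permittivity_integer.
  case=> [[_]|nE|[]]; last by rewrite oppr_gt0 ltNge ltW.
    by rewrite pmulrn -mulrNz => /integer_not_break.
  by move/eqP: nE; rewrite oppr_eq0 (gt_eqF n0').
have eC : (eps1 omega)%:C%C != 0 by rewrite -(inj_eq (@complexI R)) in e1.
(* A mode with zero data at the interface is zero on both half lines. *)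
have nz : (u 0 != 0) || ((eps1 omega)%:C%C * w 0 != 0).
  apply: contraNT ux0; rewrite negb_or !negbK mulf_eq0 (negPf eC)/=.
  move=> /andP[/eqP u0 /eqP w0]; apply/eqP.
  have [x0_ge0|x0_lt0] := leP 0 x0; first exact: (csolves_on_zero fB x0_ge0 (usB _) u0 w0).
  have x0' : 0 <= - x0 by rewrite oppr_ge0 ltW.
  by have := csolves_on_zero fA x0' (usA _); rewrite !opprK oppr0 u0 w0 oppr0; exact.
apply/matrixP => i j; rewrite !mxE big_ord_recl big_ord1 !mxE/=.
move: HA HB nz; set a := u 0; set b := _ * w 0 => HA HB /orP[a0|b0].
  apply: (mulfI a0); rewrite mulr0.
  transitivity (- (a * VB 1 0) * VA 0 0 - VB 0 0 * (a * VA 1 0)); first by ring.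
  by rewrite HA HB; ring.
apply: (mulfI b0); rewrite mulr0.
transitivity (VB 1 0 * (- b * VA 0 0) - b * VB 0 0 * VA 1 0); first by ring.
by rewrite -HA -HB; ring.
Qed.
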